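(* Let $\Lambda$ be a quasi-lacunary sequence, let $\alpha>-1$ and let $\mu\in\mathcal{M}_{x^{\alpha+1}}$. Let $p_1,\dots,p_n\in(1,\infty)$ with $\frac1{p_1}+\dots+\frac1{p_n}=1$. For $j\in\{1,\dots,n\}$ let $f_j\in M_\Lambda$, written $f_j=\sum_{k\geqslant0}f_{j,k}$ with $f_{j,k}\in F_k$. Then \[\Big|\int_{[0,1]}\prod_{j=1}^n f_j\,\mathrm{d}\mu\Big|\lesssim\prod_{j=1}^n\Big(\sum_{k\geqslant0}\|f_{j,k}\|^{p_j}_{L^{p_j}(\mathrm{d}\nu_\alpha)}\Big)^{1/p_j},\] where $\mathrm{d}\nu_\alpha=(1-x)^\alpha\mathrm{d}x$ and the implicit constant does not depend on $f_1,\dots,f_n$.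
   Context: $\Lambda=(\lambda_k)_{k\geqslant0}$ is an increasing sequence of positive reals with $\sum_k1/\lambda_k<\infty$; $M_\Lambda$ is the set of finite sums $\sum a_kt^{\lambda_k}$ on $[0,1]$. $\Lambda$ is quasi-lacunary with parameters $q>1$, $N\geqslant1$ if $\Lambda$ is partitioned into consecutive disjoint blocks $E_k=\{\lambda_j: n_k\leqslant j<n_{k+1}\}$ ($0=n_0<n_1<\dots$) with $\#E_k\leqslant N$ and $q\leqslant\lambda_{n_{k+1}}/\lambda_{n_k}\leqslant q^{2N}$. $F_k=\operatorname{Span}\{t^\lambda:\lambda\in E_k\}$; every $f\in M_\Lambda$ decomposes uniquely as $\sum_k f_k$, $f_k\in F_k$, finitely many nonzero. For $\gamma>0$, $\mathcal{M}_{x^\gamma}$ is the set of positive Borel measures $\mu$ on $[0,1]$ such that $\mu([1-\varepsilon,1])\leqslant C\varepsilon^\gamma$ for all $\varepsilon\in(0,1]$, with $C$ depending only on $\mu$. *)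

(* Defs.v *)
From HB Require Import structures.
From mathcomp Require Import all_boot all_order all_algebra.
From mathcomp Require Import all_classical all_reals all_analysis.
Set Implicit Arguments. Unset Strict Implicit. Unset Printing Implicit Defensive.
Import Order.TTheory GRing.Theory Num.Theory.
Import numFieldNormedType.Exports.
Local Open Scope classical_set_scope.
Local Open Scope ring_scope.

Definition muntz_seq (R : realType) (Lam : nat -> R) : Prop :=
  0 < Lam 0%N /\ (forall k, Lam k < Lam k.+1) /\
  cvg (series (fun k => (Lam k)^-1) @ \oo).

(* Lambda is quasi-lacunary with parameters q > 1, N >= 1, the blocks being
   E_k = {lambda_j : nb k <= j < nb (k+1)}, with nb 0 = 0, nb strictly
   increasing (so the blocks partition Lambda), #E_k <= N and
   q <= lambda_{nb (k+1)} / lambda_{nb k} <= q^(2N). *)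
Definition quasi_lacunary (R : realType) (Lam : nat -> R) (q : R) (N : nat)
    (nb : nat -> nat) : Prop :=
  1 < q /\ (1 <= N)%N /\ nb 0%N = 0%N /\
  (forall k, (nb k < nb k.+1)%N) /\
  (forall k, (nb k.+1 - nb k <= N)%N) /\
  (forall k, q <= Lam (nb k.+1) / Lam (nb k) <= q ^+ (2 * N)).

(* Element of M_Lambda with coefficient sequence a: t |-> sum_i a_i t^{lambda_i}
   (a is supported in [0, m)). *)
Definition muntz_poly (R : realType) (Lam : nat -> R) (m : nat) (a : nat -> R)
    (t : R) : R :=
  \sum_(i < m) a i * t `^ Lam i.

Definition muntz_block (R : realType) (Lam : nat -> R) (nb : nat -> nat)
    (a : nat -> R) (k : nat) (t : R) : R :=
  \sum_(nb k <= i < nb k.+1) a i * t `^ Lam i.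

Definition in_M_class (R : realType) (mu : {measure set R -> \bar R})
    (gamma : R) : Prop :=
  exists C : R, forall eps : R, 0 < eps <= 1 ->
    (mu `[(1 - eps)%R, 1%R]%classic <= (C * powR eps gamma)%R%:E)%E.

Definition nu_norm_pow (R : realType) (alpha p : R) (g : R -> R) : \bar R :=
  (\int[lebesgue_measure]_(x in `[0%R, 1%R]%classic) (powR `|g x| p * powR (1 - x) alpha)%R%:E)%E.

(* Main.v *)
Require Import Defs.
From HB Require Import structures.
From mathcomp Require Import all_boot all_order all_algebra.
From mathcomp Require Import all_classical all_reals all_analysis.
From mathcomp Require Import measurable_realfun ring lra zify.
Set Implicit Arguments. Unset Strict Implicit. Unset Printing Implicit Defensive.
Import Order.TTheory GRing.Theory Num.Theory.
Import numFieldNormedType.Exports.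
Local Open Scope classical_set_scope.
Local Open Scope ring_scope.

(* By the weighted AM-GM inequality with exponents p_j, after normalising each f_j
   by the corresponding factor of the right-hand side, it suffices to show for
   each p > 1 that
     int |f|^p dmu <= C sum_k ||f_k||^p_{L^p(nu_alpha)}.
   A block f_k with lowest exponent L_k becomes, under t = e^{-s/L_k}, an
   exponential sum with at most N exponents in [1, q^{2N}].  A Turan type
   inequality, uniform in the gaps between the exponents, bounds it on s >= 0 by
   its values at finitely many separated nodes, times a factor e^{-s/2}.  Choosing
   the nodes well gives
     |f_k(t)|^p <= C L_k^{alpha+1} e^{-p L_k (1-t)/2} ||f_k||^p.
   A Schur test over the lacunary sequence (L_k) then reduces the claim to
     int e^{-L(1-x)} (1-x)^{-(alpha+1)/2} dmu <= C L^{-(alpha+1)/2},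
   which follows by cutting [0,1) into the dyadic shells 1-x ~ 2^{-j}. *)

(** * Exponentials, powers and a Turan type inequality *)

Lemma expR_powR (R : realType) (x s : R) : (expR x) `^ s = expR (s * x).
Proof. by rewrite /powR gt_eqF ?expR_gt0// expRK. Qed.

(** The inequality [z <= expR z] at [z = c / s * y], raised to the power [s]. It is used to trade a
    power for a small part of an exponential decay. *)
Lemma powR_le_expR (R : realType) (s c : R) : 0 < s -> 0 < c ->
  forall y : R, 0 <= y -> y `^ s <= (s / c) `^ s * expR (c * y).
Proof.
move=> s0 c0 y y0.
have sc0 : 0 < s / c by rewrite divr_gt0.
have -> : expR (c * y) = (expR (c / s * y)) `^ s.
  by rewrite expR_powR; congr expR; field; rewrite gt_eqF.
rewrite -powRM ?expR_ge0 ?(ltW sc0)//.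
apply: ge0_ler_powR; rewrite ?nnegrE//; [exact: ltW|by rewrite mulr_ge0 ?expR_ge0 ?ltW|].
have yE : s / c * (c / s * y) = y by field; rewrite !gt_eqF.
rewrite -[leLHS]yE ler_pM2l//.
by have := expR_ge1Dx (c / s * y); lra.
Qed.

Lemma is_derive_expsum (R : realType) n (a c : nat -> R) (x : R) :
  is_derive x 1 (fun s : R => \sum_(j < n) a j * expR (c j * s))
    (\sum_(j < n) a j * (c j * expR (c j * x))).
Proof.
have -> : (fun s : R => \sum_(j < n) a j * expR (c j * s)) =
          \sum_(j < n) (a j \*: (expR \o (c j \*: id))).
  by apply/funext => s; rewrite fct_sumE.
apply: is_derive_sum => j; apply: is_deriveZ.
rewrite mulrC; apply: is_derive1_comp.
by apply: is_derive_eq; rewrite /GRing.scale/= mulr1.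
Qed.

(* Induction on the number of exponents: dividing out the last exponential and
   differentiating removes it, and the mean value theorem on disjoint pairs of
   nodes provides half as many separated nodes for the derivative.  Nothing is
   assumed on the gaps between the exponents. *)
Lemma expsum_bound (R : realType) (Q B : R) : 0 <= B -> forall n : nat,
  exists2 K : R, 0 <= K & forall (a rho s : nat -> R) (e : R),
    (forall j, (j < n)%N -> 1 <= rho j <= Q) ->
    (forall k, (k < 2 ^ n)%N -> 0 <= s k <= B) ->
    (forall k, (k.+1 < 2 ^ n)%N -> s k + 1 <= s k.+1) ->
    (forall k, (k < 2 ^ n)%N ->
       `|\sum_(j < n) a j * expR (- rho j * s k)| <= e) ->
    forall x : R, 0 <= x ->
      `|\sum_(j < n) a j * expR (- rho j * x)| <= K * e * (1 + x) ^+ n * expR (- x).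
Proof.
move=> B0; elim=> [|n [K K0 IH]].
  by exists 0 => // a rho s e _ _ _ _ x x0; rewrite big_ord0 normr0 !mul0r.
(* Bounds [expR (rho j * x)] for all nodes [x] in [[0, B]]. *)
pose E := expR (Q * B).
have E0 : 0 < E by exact: expR_gt0.
(* The first [E] pays for the value of [H] at the node [s 0], the second summand for the increment
   of [H] from there to [x]. *)
exists (E + E * (K * (2 * E)) * (1 + B) ^+ n.+1).
  by rewrite addr_ge0 ?mulr_ge0 ?exprn_ge0 ?addr_ge0 ?(ltW E0).
move=> a rho s e hrho hs hgap hnode.
have e0 : 0 <= e by apply: le_trans (hnode 0%N _); rewrite ?expn_gt0.
set h := fun x : R => \sum_(j < n.+1) a j * expR (- rho j * x).
pose r := rho n.
have /andP[r1 rQ] : 1 <= r <= Q by apply: hrho.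
(* Multiplying [h] by [expR (r * x)] makes the last term constant, so [H' = expR (r * x) * G x]
   where [G] has only [n] exponents. *)
pose b j := a j * (r - rho j).
pose G := fun x : R => \sum_(j < n) b j * expR (- rho j * x).
pose H := fun x : R => \sum_(j < n.+1) a j * expR ((r - rho j) * x).
have HE (x : R) : H x = expR (r * x) * h x.
  rewrite /H /h mulr_sumr; apply: eq_bigr => j _.
  by rewrite mulrCA -expRD; congr (_ * expR _); ring.
have dH (x : R) : is_derive x 1 H (expR (r * x) * G x).
  have := @is_derive_expsum R n.+1 a (fun j => r - rho j) x.
  rewrite big_ord_recr /= subrr mul0r mulr0 addr0 => /is_derive_eq; apply.
  rewrite /G mulr_sumr; apply: eq_bigr => j _.
  rewrite /b mulrA [RHS]mulrCA -expRD; congr (_ * expR _); ring.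
have mvt (x y : R) : x <= y ->
    exists2 c, x <= c <= y & H y - H x = expR (r * c) * G c * (y - x).
  move=> xy; have [|c cxy ->] := @MVT_segment R H (fun c => expR (r * c) * G c) x y xy (fun z _ => dH z).
    apply: derivable_within_continuous => z _; exact: ex_derive.
  by exists c => //; move: cxy; rewrite in_itv.
have expB (x : R) : x <= B -> 0 <= x -> expR (r * x) <= E.
  move=> xB x0; rewrite ler_expR; apply: ler_pM => //; exact: le_trans r1.
(* The nodes are paired as [s k.*2], [s k.*2.+1]. Within a pair the gap is at least 1 and
   [expR (r * c) >= 1], so the increment of [H], at most [2 * E * e], bounds [G c] itself. Gaps
   between pairs keep the new nodes separated. The value 0 is a filler for indices out of range. *)
have xi_ex k : exists c, (k < 2 ^ n)%N ->
    s k.*2 <= c <= s k.*2.+1 /\ `|G c| <= 2 * E * e.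
  have [kn|] := boolP (k < 2 ^ n)%N; last by exists 0.
  have k1 : (k.*2.+1 < 2 ^ n.+1)%N by rewrite expnS; lia.
  have k2 := ltnW k1.
  have /andP[s0 sB] := hs _ k2; have /andP[s0' sB'] := hs _ k1.
  have gap := hgap _ k1.
  have [|c /andP[c1 c2] cE] := mvt (s k.*2) (s k.*2.+1); first lra.
  exists c => _; split; first by rewrite c1 c2.
  have n1 : `|H (s k.*2)| <= E * e.
    by rewrite HE normrM ger0_norm ?expR_ge0// ler_pM ?expR_ge0// ?expB// hnode.
  have n2 : `|H (s k.*2.+1)| <= E * e.
    by rewrite HE normrM ger0_norm ?expR_ge0// ler_pM ?expR_ge0// ?expB// hnode.
  have c0 : 1 <= expR (r * c).
    by rewrite -expR0 ler_expR mulr_ge0//; lra.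
  have : `|expR (r * c) * G c * (s k.*2.+1 - s k.*2)| <= 2 * E * e.
    rewrite -cE; apply: le_trans (ler_normB _ _) _; lra.
  apply: le_trans; rewrite !normrM (ger0_norm (expR_ge0 _)).
  rewrite -[leLHS]mul1r -[leLHS]mulr1 ler_pM ?mulr_ge0 ?mul1r ?ler_peMl//.
  by rewrite ger0_norm; lra.
have [xi hxi] := choice xi_ex.
have hG (x : R) : 0 <= x -> `|G x| <= K * (2 * E * e) * (1 + x) ^+ n * expR (- x).
  apply: (IH b rho xi).
  - by move=> j jn; apply: hrho; exact: ltnW.
  - move=> k kn; have [/andP[c1 c2] _] := hxi _ kn.
    have k1 : (k.*2.+1 < 2 ^ n.+1)%N by rewrite expnS; lia.
    have := hs _ k1; have := hs _ (ltnW k1); lra.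
  - move=> k kn; have [/andP[_ c2] _] := hxi _ (ltnW kn).
    have [/andP[c1 _] _] := hxi _ kn.
    have := hgap k.*2.+1; rewrite -doubleS => /(_ _).
    have k1 : (k.+1.*2 < 2 ^ n.+1)%N by rewrite expnS; lia.
    move=> /(_ k1); lra.
  - by move=> k /hxi[].
move=> x x0.
have /andP[s00 s0B] : 0 <= s 0%N <= B by apply: hs; rewrite expn_gt0.
have hH0 : `|H (s 0%N)| <= E * e.
  by rewrite HE normrM ger0_norm ?expR_ge0// ler_pM ?expR_ge0// ?expB// hnode ?expn_gt0.
(* The point [c] lies between [x] and [s 0], in either order, hence below [x + B]. *)
have [c /andP[c0 cxB] cE] : exists2 c, 0 <= c <= x + B &
    `|H x - H (s 0%N)| = expR (r * c) * `|G c| * `|x - s 0%N|.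
  have [xs|/ltW xs] := leP x (s 0%N).
    have [c cxy cE] := mvt _ _ xs; exists c; first lra.
    by rewrite distrC cE !normrM (ger0_norm (expR_ge0 _)) (distrC x).
  have [c cxy cE] := mvt _ _ xs; exists c; first lra.
  by rewrite cE !normrM (ger0_norm (expR_ge0 _)).
have hd : `|H x - H (s 0%N)| <=
    expR ((r - 1) * (x + B)) * (K * (2 * E * e)) * ((1 + B) * (1 + x)) ^+ n.+1.
  have m1 : `|x - s 0%N| <= (1 + B) * (1 + x).
    by rewrite ler_norml; apply/andP; split; nra.
  rewrite cE exprSr mulrA ler_pM ?mulr_ge0 ?expR_ge0//.
  apply: le_trans (ler_wpM2l (expR_ge0 _) (hG _ c0)) _.
  rewrite [leLHS](_ : _ = expR ((r - 1) * c) * (K * (2 * E * e)) * (1 + c) ^+ n).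
    have ? := mulr_ge0 (mulr_ge0 (ler0n R 2) (ltW E0)) e0.
    rewrite ler_pM ?mulr_ge0 ?exprn_ge0 ?expR_ge0//; try lra.
    - rewrite ler_wpM2r ?mulr_ge0//; first by have := ltW E0; lra.
      by rewrite ler_expR ler_wpM2l//; lra.
    - by rewrite lerXn2r// ?nnegrE; nra.
  have -> : expR ((r - 1) * c) = expR (r * c) * expR (- c) by rewrite -expRD; congr expR; ring.
  ring.
rewrite -[X in `|X|]/(h x); have -> : h x = expR (- (r * x)) * H x by rewrite HE mulrA -expRD addNr expR0 mul1r.
rewrite normrM ger0_norm ?expR_ge0//.
have Hx : `|H x| <= E * e + expR ((r - 1) * (x + B)) * (K * (2 * E * e)) *
   ((1 + B) * (1 + x)) ^+ n.+1.
  have := ler_normD (H x - H (s 0%N)) (H (s 0%N)); rewrite subrK; lra.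
apply: le_trans (ler_wpM2l (expR_ge0 _) Hx) _.
set P := (1 + B) ^+ n.+1; set X := (1 + x) ^+ n.+1.
have X1 : 1 <= X by rewrite exprn_ege1//; lra.
have P0 : 0 <= P by rewrite exprn_ge0//; lra.
have T1 : expR (- (r * x)) * (E * e) <= E * e * X * expR (- x).
  have Ee : 0 <= E * e by rewrite mulr_ge0// ltW.
  have rx : expR (- (r * x)) <= expR (- x) by rewrite ler_expR; nra.
  by rewrite [leLHS]mulrC ler_pM ?expR_ge0 ?ler_peMr.
(* The exponents add up to [(r - 1) * B - x], and [(r - 1) * B <= Q * B]: the decay [expR (- x)]
   survives. *)
have T2 : expR (- (r * x)) * expR ((r - 1) * (x + B)) <= E * expR (- x).
  by rewrite /E -!expRD ler_expR; nra.
rewrite mulrDr exprMn -/P -/X [leRHS](_ : _ = E * e * X * expR (- x) +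
  E * expR (- x) * (K * (2 * E * e) * (P * X))); last by ring.
rewrite lerD//.
have W0 : 0 <= K * (2 * (E * (e * (P * X)))).
  by rewrite !mulr_ge0// ?(ltW E0)//; lra.
have -> : expR (- (r * x)) * (expR ((r - 1) * (x + B)) * (K * (2 * E * e)) * (P * X)) =
    expR (- (r * x)) * expR ((r - 1) * (x + B)) * (K * (2 * (E * (e * (P * X))))) by ring.
have -> : E * expR (- x) * (K * (2 * E * e) * (P * X)) =
    E * expR (- x) * (K * (2 * (E * (e * (P * X))))) by ring.
by rewrite ler_wpM2r.
Qed.

(** * Lacunary sums and convexity inequalities *)

(** A telescoping argument makes the constant the same for all sequences of ratio at least [r]. This
    uniformity matters, since the lemma is applied to rescaled sequences such as [L k * (1 - t)]. *)
Lemma lacunary_bump_sum (R : realType) (s c r : R) : 0 < s -> 0 < c -> 1 < r ->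
  exists2 C : R, 0 < C & forall y : nat -> R, (forall k, 0 < y k) ->
    (forall k, r * y k <= y k.+1) ->
    forall m, \sum_(k < m) y k `^ s * expR (- (c * y k)) <= C.
Proof.
move=> s0 c0 r1.
pose rho := r `^ s.
have rho1 : 1 < rho.
  by have := @gt0_ltr_powR R s s0 1 r; rewrite powR1; apply => //; rewrite nnegrE; lra.
(* The constant of [powR_le_expR] for the exponent [2 * s], that is, for [z k ^+ 2] against
   [expR (c * y k)]. *)
pose A := (2 * s / c) `^ (2 * s).
have A0 : 0 <= A by exact: powR_ge0.
pose D := (2 + 2 * A) * (rho / (rho - 1)).
have D0 : 0 < D by rewrite mulr_gt0 ?divr_gt0//; lra.
exists D => // y y0 yr m.
pose z k := y k `^ s.
have z0 k : 0 < z k by exact: powR_gt0.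
have zr k : rho * z k <= z k.+1.
  rewrite /rho /z -powRM ?(ltW (y0 k))//; last lra.
  apply: ge0_ler_powR; rewrite ?nnegrE ?(ltW (y0 _)) ?(ltW s0)//.
  by rewrite mulr_ge0 ?(ltW (y0 k))//; lra.
(* the increments of z / (1 + z) along a lacunary sequence dominate the bumps *)
have step k : y k `^ s * expR (- (c * y k)) <= D * ((1 + z k)^-1 - (1 + z k.+1)^-1).
  have zk0 := z0 k; have zk1 := z0 k.+1; have zrk := zr k.
  have expE : (1 + z k) ^+ 2 * expR (- (c * y k)) <= 2 + 2 * A.
    have h2 : z k ^+ 2 <= A * expR (c * y k).
      rewrite -powR_mulrn ?(ltW zk0)// -powRrM mulrC.
      by apply: powR_le_expR; rewrite ?(ltW (y0 k))//; lra.
    have h1 : 1 <= expR (c * y k) by rewrite -expR0 ler_expR mulr_ge0 ?(ltW (y0 k)) ?(ltW c0).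
    have : (1 + z k) ^+ 2 <= (2 + 2 * A) * expR (c * y k).
      by have := sqr_ge0 (z k - 1); lra.
    by rewrite expRN ler_pdivrMr ?expR_gt0//.
  rewrite -/(z k).
  have h3 : z k / (1 + z k) ^+ 2 * ((rho - 1) / rho) <= (1 + z k)^-1 - (1 + z k.+1)^-1.
    rewrite -subr_ge0.
    (* Over a common denominator the numerator splits into two nonnegative terms, the first of them
       by lacunarity. *)
    have -> : (1 + z k)^-1 - (1 + z k.+1)^-1 - z k / (1 + z k) ^+ 2 * ((rho - 1) / rho) =
      ((z k.+1 - rho * z k) * (rho + z k) + z k * (rho - 1) ^+ 2) /
      ((1 + z k) ^+ 2 * (1 + z k.+1) * rho).
      by field; rewrite !gt_eqF//; lra.
    rewrite divr_ge0// ?addr_ge0 ?mulr_ge0 ?exprn_ge0//; lra.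
  apply: (@le_trans _ _ (D * (z k / (1 + z k) ^+ 2 * ((rho - 1) / rho)))); last first.
    by rewrite ler_wpM2l ?(ltW D0).
  have -> : D * (z k / (1 + z k) ^+ 2 * ((rho - 1) / rho)) =
     z k * ((2 + 2 * A) / (1 + z k) ^+ 2).
    by rewrite /D; field; rewrite !gt_eqF//; lra.
  by rewrite ler_wpM2l ?(ltW zk0)// ler_pdivlMr ?exprn_gt0 ?addr_gt0// mulrC.
apply: le_trans (ler_sum _ (fun (k : 'I_m) _ => step k)) _.
rewrite -mulr_sumr.
rewrite (_ : \sum_(i < m) _ = (1 + z 0%N)^-1 - (1 + z m)^-1); last first.
  by elim: m => [|m IH]; rewrite ?big_ord0 ?subrr// big_ord_recr/= IH; ring.
rewrite -[leRHS]mulr1 ler_wpM2l ?(ltW D0)// lerBlDr ler_wpDr//.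
  by rewrite invr_ge0 addr_ge0 ?(ltW (z0 _)).
by rewrite invf_le1 ?lerDl ?(ltW (z0 _))// addr_gt0.
Qed.

(** Young's inequality for the product of [u] and 1 with the conjugate exponents [p] and
    [p / (p - 1)], multiplied by [p]. *)
Lemma bernoulli_powR (R : realType) (p u : R) : 1 < p -> 0 <= u ->
  1 + p * (u - 1) <= u `^ p.
Proof.
move=> p1 u0.
have p0 : 0 < p by lra.
have q0 : 0 < p / (p - 1) by rewrite divr_gt0//; lra.
have := @conjugate_powR R u 1 p (p / (p - 1)) u0 ler01 p0 q0.
have -> : p^-1 + (p / (p - 1))^-1 = 1 by field; rewrite !gt_eqF//; lra.
move=> /(_ erefl); rewrite powR1 mulr1 mul1r => h.
have := ler_wpM2l (ltW p0) h.
have -> : p * (u `^ p / p + (p / (p - 1))^-1) = u `^ p + (p - 1) by field; rewrite !gt_eqF//; lra.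
lra.
Qed.

(** Jensen's inequality for the power [p] with weights [w]. Bernoulli at [y k / A], with [A] the
    weighted mean, is the tangent line there; its linear terms cancel in the weighted sum. *)
Lemma powR_sum_le (R : realType) (p : R) m (w y : 'I_m -> R) : 1 < p ->
  (forall k, 0 <= w k) -> (forall k, 0 <= y k) ->
  (\sum_k w k * y k) `^ p <= (\sum_k w k) `^ (p - 1) * \sum_k w k * y k `^ p.
Proof.
move=> p1 w0 y0.
have p0 : 0 < p by lra.
set S := \sum_k w k * y k; set W := \sum_k w k.
have W0 : 0 <= W by exact: sumr_ge0.
have S0 : 0 <= S by apply: sumr_ge0 => k _; rewrite mulr_ge0.
have [SE|S1] := eqVneq S 0.
  rewrite SE powR0 ?gt_eqF// mulr_ge0 ?powR_ge0//.
  by apply: sumr_ge0 => k _; rewrite mulr_ge0 ?powR_ge0.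
have W1 : W != 0.
  apply: contra S1 => /eqP WE; apply/eqP/big1 => k _.
  have : w k <= 0.
    by rewrite -WE /W (bigD1 k)//= lerDl sumr_ge0.
  by move=> wk; have -> : w k = 0 by [apply/eqP; rewrite eq_le wk w0]; rewrite mul0r.
have S2 : 0 < S by rewrite lt_def S1.
have W2 : 0 < W by rewrite lt_def W1.
pose A := S / W.
have A0 : 0 < A by rewrite divr_gt0.
have key : W <= \sum_k w k * (y k / A) `^ p.
  have : \sum_k w k * (1 + p * (y k / A - 1)) <= \sum_k w k * (y k / A) `^ p.
    by apply: ler_sum => k _; rewrite ler_wpM2l// bernoulli_powR// divr_ge0// ltW.
  apply: le_trans.
  have -> : \sum_k w k * (1 + p * (y k / A - 1)) = (1 - p) * W + p / A * S.
    by rewrite /W /S !mulr_sumr -big_split/=; apply: eq_bigr => k _; ring.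
  by rewrite /A le_eqVlt; apply/orP; left; apply/eqP; field; rewrite W1 S1.
have SE : S = W * A by rewrite /A; field.
rewrite {1}SE powRM ?(ltW A0)//.
have -> : W `^ p = W `^ (p - 1) * W.
  by rewrite mulrC mulr_powRB1.
rewrite -mulrA ler_wpM2l ?powR_ge0//.
have -> : \sum_k w k * y k `^ p = (\sum_k w k * (y k / A) `^ p) * A `^ p.
  rewrite mulr_suml; apply: eq_bigr => k _; rewrite -mulrA -powRM ?divr_ge0 ?(ltW A0)//.
  by rewrite divfK// gt_eqF.
by rewrite ler_wpM2r ?powR_ge0.
Qed.

(** Weighted AM-GM. With [S] the right-hand side, [1 + z <= expR z] at [z = p j * ln (y j) - ln S]
    is summed with weights [(p j)^-1]; the upper bounds add up to 0. Vanishing factors are set aside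
    because of the logarithm. *)
Lemma young_prod (R : realType) n (p y : 'I_n -> R) : (forall j, 0 < p j) ->
  \sum_j (p j)^-1 = 1 -> (forall j, 0 <= y j) ->
  \prod_j y j <= \sum_j (p j)^-1 * y j `^ p j.
Proof.
move=> p0 pE y0.
have [/existsP[j /eqP yj]|] := boolP [exists j, y j == 0].
  rewrite (bigD1 j)//= yj mul0r sumr_ge0// => i _.
  by rewrite mulr_ge0 ?powR_ge0// invr_ge0 ltW.
rewrite negb_exists => /forallP yn0.
have y1 j : 0 < y j by rewrite lt_def yn0 y0.
set S := \sum_j _.
have S0 : 0 < S.
  (* For [n = 0] the weights would sum to 0 instead of 1. *)
  have n0 : (0 < n)%N.
    case: n p y p0 pE y0 yn0 y1 @S => // p y p0; rewrite big_ord0 => /eqP.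
    by rewrite eq_sym oner_eq0.
  rewrite /S (bigD1 (Ordinal n0))//= ltr_pwDl ?mulr_gt0 ?invr_gt0 ?powR_gt0//.
  by rewrite sumr_ge0// => i _; rewrite mulr_ge0 ?powR_ge0// invr_ge0 ltW.
have prodE : \prod_j y j = expR (\sum_j ln (y j)).
  by rewrite expR_sum; apply: eq_bigr => j _; rewrite lnK// posrE.
rewrite prodE -[leRHS]lnK ?posrE// ler_expR -subr_le0.
have step j : (p j)^-1 * (p j * ln (y j) - ln S) <= (p j)^-1 * (y j `^ p j / S - 1).
  rewrite ler_wpM2l ?invr_ge0 ?(ltW (p0 j))//.
  have := expR_ge1Dx (p j * ln (y j) - ln S).
  have -> : expR (p j * ln (y j) - ln S) = y j `^ p j / S.
    by rewrite expRB lnK ?posrE// /powR (negbTE (yn0 j)).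
  lra.
have : \sum_j (p j)^-1 * (p j * ln (y j) - ln S) <=
    \sum_j (p j)^-1 * (y j `^ p j / S - 1) by apply: ler_sum => j _; exact: step.
have -> : \sum_j (p j)^-1 * (p j * ln (y j) - ln S) = \sum_j ln (y j) - ln S.
  under eq_bigr do rewrite mulrBr mulKf ?gt_eqF//.
  by rewrite sumrB -mulr_suml pE mul1r.
have -> : \sum_j (p j)^-1 * (y j `^ p j / S - 1) = 0; last by [].
under eq_bigr do rewrite mulrBr mulr1 mulrA.
by rewrite sumrB -mulr_suml pE divff ?subrr// gt_eqF.
Qed.

(** * Integrals of the kernel against [mu] *)

Lemma dyadic_shell (R : realType) (u : R) : 0 < u <= 1 ->
  exists j : nat, 2^-1 ^+ j.+1 < u <= 2^-1 ^+ j.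
Proof.
move=> /andP[u0 u1].
have ex : exists j : nat, 2^-1 ^+ j < u.
  have [n] : exists n : nat, u^-1 < n%:R.
    by exists (Num.bound u^-1); rewrite archi_boundP// invr_ge0 ltW.
  move=> un; exists n; rewrite exprVn invf_plt ?posrE ?exprn_gt0//.
  by apply: lt_le_trans un _; rewrite -natrX ler_nat ltnW// ltn_expl.
(* The least exponent with [2^-1 ^+ j < u] is a successor, since exponent 0 would give [1 < u]. *)
have [[|j] hj min] := find_ex_minn ex.
  by move: hj; rewrite expr0; lra.
exists j; rewrite hj/= leNgt; apply/negP => /min; lia.
Qed.

(** The bound of the kernel on the shell at distance [2^-1 ^+ j] from 1, times the measure of the
    interval containing it, is a multiple of [L ^ (t - g)] times a bump in [L * 2^-1 ^+ j] with
    positive exponent [g - t]; the bumps have a bounded sum. *)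
Lemma M_class_kernel_integral (R : realType) (mu : {measure set R -> \bar R})
    (g t : R) : in_M_class mu g -> 0 < t < g ->
  exists2 C : R, 0 < C & forall L : R, 0 < L ->
    (\int[mu]_(x in `[0%R, 1%R]%classic)
        (expR (- (L * (1 - x))) * (1 - x) `^ (- t))%:E <= (C * L `^ (t - g))%:E)%E.
Proof.
move=> [C0 hC0] /andP[t0 tg].
have gt0 : 0 < g - t by lra.
have h2 : (0 : R) < 2^-1 by rewrite invr_gt0.
have C00 : 0 <= C0.
  have := hC0 1; rewrite ltr01 lexx powR1 mulr1 => /(_ isT).
  by move=> /(le_trans (measure_ge0 _ _)); rewrite lee_fin.
have [|C1 C10 hC1] := @lacunary_bump_sum R (g - t) 2^-1 2 gt0 h2; first by lra.
pose C := C0 * 2 `^ t * C1 + 1.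
have C'0 : 0 <= C0 * 2 `^ t * C1 by rewrite !mulr_ge0 ?powR_ge0 ?(ltW C10).
exists C; first by rewrite /C; lra.
move=> L L0.
pose d (j : nat) : R := 2^-1 ^+ j.
have d0 j : 0 < d j by exact: exprn_gt0.
have d1 j : d j <= 1 by rewrite exprn_ile1//; lra.
(* [E j] is the full interval up to 1, whose measure the class controls, and [term j] bounds the
   kernel on the shell inside it: the exponential and the power are both estimated at the inner
   radius [d j.+1]. *)
pose E j : set R := `[1 - d j, 1]%classic.
pose term j : R := expR (- (L / 2 * d j)) * d j.+1 `^ (- t).
have term0 j : 0 <= term j by rewrite mulr_ge0 ?expR_ge0 ?powR_ge0.
have mE j : measurable (E j) by exact: measurable_itv.
pose F (j : nat) (x : R) : \bar R := (term j * \1_(E j) x)%:E.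
have F0 j x : (0 <= F j x)%E by rewrite lee_fin mulr_ge0.
have mF j : measurable_fun (`[0%R, 1%R]%classic : set R) (F j).
  by apply/measurable_EFinP; apply: measurable_funM.
have pw x : x \in `[0%R, 1%R] ->
    ((expR (- (L * (1 - x))) * (1 - x) `^ (- t))%:E <= \sum_(j <oo) F j x)%E.
  rewrite in_itv/= => /andP[x0 x1].
  (* At [x = 1] the kernel is 0 by the convention that [powR] sends 0 to 0 for a nonzero
     exponent. *)
  have [->|x1'] := eqVneq x 1.
    rewrite subrr powR0 ?mulr0; last by rewrite oppr_eq0 gt_eqF.
    by apply: nneseries_ge0 => j _ _.
  have [|j /andP[uj1 uj2]] := @dyadic_shell R (1 - x).
    by apply/andP; split; [rewrite subr_gt0 lt_neqAle x1'|lra].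
  apply: (@le_trans _ _ (F j x)).
    rewrite /F indicE mem_set ?mulr1; last by rewrite /E/= in_itv/= x1 andbT /d; lra.
    rewrite lee_fin ler_pM ?expR_ge0 ?powR_ge0//.
      by rewrite ler_expR lerN2 -mulrA ler_wpM2l ?(ltW L0)// -/(d j.+1) /d -exprS ltW.
    rewrite !powRN lef_pV2 ?posrE ?powR_gt0//; last by apply: le_lt_trans uj1; rewrite ltW.
    by apply: ge0_ler_powR; rewrite ?nnegrE ?(ltW t0) ?(ltW (d0 _)) ?(ltW uj1)//; lra.
  apply: le_trans (nneseries_lim_ge j.+1 _) => //.
  by rewrite big_nat_recr//= leeDr// sume_ge0.
have mK : measurable_fun (`[0%R, 1%R]%classic : set R)
    (fun x => (expR (- (L * (1 - x))) * (1 - x) `^ (- t))%:E).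
  apply/measurable_EFinP; apply: measurable_funTS; apply: measurable_funM.
    apply: measurableT_comp => //; apply: measurableT_comp => //.
    by apply: measurable_funM => //; exact: measurable_funB.
  by apply: (measurableT_comp (measurable_powR _)); exact: measurable_funB.
apply: (@le_trans _ _ (\int[mu]_(x in `[0%R, 1%R]%classic) \sum_(j <oo) F j x)%E).
  apply: ge0_le_integral => //.
    by move=> x _; rewrite lee_fin mulr_ge0 ?expR_ge0 ?powR_ge0.
  exact: (@ge0_emeasurable_sum _ _ _ _ F xpredT).
rewrite integral_nneseries//.
apply: lime_le; first by apply: is_cvg_nneseries => j _ _; exact: integral_ge0.
apply: nearW => m.
have intF j : (\int[mu]_(x in `[0%R, 1%R]%classic) F j x <=
     (C0 * 2 `^ t * L `^ (t - g) * ((L * d j) `^ (g - t) * expR (- (2^-1 * (L * d j)))))%:E)%E.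
  rewrite /F; under eq_integral do rewrite EFinM.
  rewrite ge0_integralZl_EFin//; last first.
    apply/measurable_EFinP.
    exact: measurable_indic.
  rewrite integral_indic//.
  have : (mu (E j `&` `[0%R, 1%R]%classic) <= (C0 * d j `^ g)%:E)%E.
    apply: le_trans (hC0 (d j) _); last by rewrite d0 d1.
    by apply: le_measure; rewrite ?inE//; exact: measurableI.
  move=> /(lee_wpmul2l (x := (term j)%:E)); rewrite lee_fin => /(_ (term0 j)).
  move=> /le_trans; apply; rewrite -EFinM lee_fin le_eqVlt; apply/orP; left; apply/eqP.
  rewrite /term.
  have -> : d j.+1 `^ (- t) = 2 `^ t * d j `^ (- t).
    rewrite /d exprS powRM ?(ltW h2) ?exprn_ge0 ?(ltW h2)//; congr (_ * _).
    by rewrite -[in LHS](@powR_inv1 _ 2)// -powRrM mulN1r opprK.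
  have -> : d j `^ (- t) = d j `^ (g - t) / d j `^ g.
    by rewrite -powRB ?(gt_eqF (d0 j)) ?implybT//; congr (_ `^ _); ring.
  rewrite powRM ?(ltW L0) ?(ltW (d0 j))//.
  have -> : L `^ (g - t) = (L `^ (t - g))^-1 by rewrite -powRN; congr (_ `^ _); ring.
  have -> : 2^-1 * (L * d j) = L / 2 * d j by ring.
  by field; rewrite !gt_eqF ?powR_gt0.
rewrite (le_trans (lee_sum _ (fun j _ => intF j)))//.
rewrite sumEFin lee_fin big_mkord -mulr_sumr.
(* The radii decrease, so the sum is reversed to obtain a sequence growing with ratio 2. *)
have -> : \sum_(i < m) (L * d i) `^ (g - t) * expR (- (2^-1 * (L * d i))) =
   \sum_(i < m) (L * d m.-1 * 2 ^+ i) `^ (g - t) * expR (- (2^-1 * (L * d m.-1 * 2 ^+ i))).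
  rewrite (reindex_inj rev_ord_inj)/=; apply: eq_bigr => i _.
  have -> : L * d (m - i.+1)%N = L * d m.-1 * 2 ^+ i.
    rewrite -mulrA; congr (_ * _); rewrite /d.
    have -> : m.-1 = ((m - i.+1) + i)%N by have := ltn_ord i; lia.
    by rewrite exprD -mulrA -exprMn mulVf ?expr1n ?mulr1.
  by [].
rewrite /C; set S := \sum_(i < m) _.
have S1 : S <= C1.
  apply: (hC1 (fun i => L * d m.-1 * 2 ^+ i)) => k; first by rewrite !mulr_gt0// exprn_gt0.
  by rewrite exprS; lra.
have Lp : 0 <= L `^ (t - g) by exact: powR_ge0.
have Q0 : 0 <= C0 * 2 `^ t by rewrite mulr_ge0 ?powR_ge0.
have := ler_wpM2l (mulr_ge0 Q0 Lp) S1; lra.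
Qed.

(** * Pointwise bounds for a single block *)

(** By monotonicity the minimum is at the left end for [alpha >= 0] and at the right end
    otherwise. *)
Lemma powR_ge_on_interval (R : realType) (alpha k B : R) : 0 < k -> k <= B ->
  exists2 d : R, 0 < d & forall y : R, k <= y <= B -> d <= y `^ alpha.
Proof.
move=> k0 kB; have B0 : 0 < B by lra.
have [a0|/ltW a0] := leP 0 alpha.
  exists (k `^ alpha) => [|y /andP[ky yB]]; first exact: powR_gt0.
  by apply: ge0_ler_powR; rewrite ?nnegrE//; lra.
exists (B `^ alpha) => [|y /andP[ky yB]]; first exact: powR_gt0.
rewrite -[alpha]opprK powRN [leRHS]powRN lef_pV2 ?posrE ?powR_gt0//; last lra.
by apply: ge0_ler_powR; rewrite ?nnegrE//; lra.
Qed.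

(** Under [t = expR (- (s / L))] the window [[i, i + 1]] becomes an interval [T] of length
    comparable to [1 / L], on which [1 - t] is also comparable to [1 / L]. The minimum of [|g|] over
    the window is therefore controlled by the weighted integral over [T]. *)
Lemma nu_norm_node (R : realType) (alpha p ell B : R) :
  0 < p -> 0 < ell -> 1 <= B ->
  exists2 C : R, 0 < C & forall (L i : R) (g : R -> R),
    ell <= L -> 1 <= i -> i + 1 <= B -> measurable_fun [set: R] g ->
    continuous (fun s : R => g (expR (- (s / L)))) ->
    exists2 s : R, i <= s <= i + 1 &
      ((`|g (expR (- (s / L)))| `^ p)%:E <=
        (C * L `^ (alpha + 1))%:E * nu_norm_pow alpha p g)%E.
Proof.
move=> p0 ell0 B1.
(* A lower bound for [expR (- (s / L))] valid for all [s <= B] and [L >= ell], which keeps the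
   constant uniform. *)
pose kap := expR (- (B / ell)).
have kap0 : 0 < kap by exact: expR_gt0.
have kap1 : kap <= 1 by rewrite -expR0 ler_expR oppr_le0 divr_ge0//; lra.
have [|d d0 hd] := @powR_ge_on_interval R alpha kap B kap0; first lra.
exists (d * kap)^-1; first by rewrite invr_gt0 mulr_gt0.
move=> L i g ellL i1 iB mg cg.
have L0 : 0 < L by lra.
have Linv : 0 < L^-1 by rewrite invr_gt0.
have kapL x : x <= B -> kap <= expR (- (x / L)).
  move=> xB; rewrite ler_expR lerN2.
  apply: (@le_trans _ _ (B / L)); first by rewrite ler_wpM2r ?(ltW Linv).
  by rewrite ler_wpM2l ?lef_pV2 ?posrE//; lra.
have [||s] := @EVT_min R (fun s => `|g (expR (- (s / L)))|) i (i + 1); first by lra.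
  apply: continuous_subspaceT => s; apply: (continuous_comp (cg s)).
  exact: norm_continuous.
rewrite in_itv/= => si smin; exists s => //.
set v := `|g (expR (- (s / L)))| `^ p.
pose T : set R := `[expR (- ((i + 1) / L)), expR (- (i / L))]%classic.
have expLn x : 0 < x -> expR (- (- L * ln x / L)) = x.
  by move=> x0; rewrite -[RHS]lnK ?posrE//; congr expR; field; rewrite gt_eqF.
have low x : T x -> v * (d * L `^ (- alpha)) <= `|g x| `^ p * (1 - x) `^ alpha.
  rewrite /T/= in_itv/= => /andP[x1 x2].
  have x0 : 0 < x by apply: lt_le_trans x1; exact: expR_gt0.
  have lnx1 : - ((i + 1) / L) <= ln x by rewrite -[leLHS]expRK ler_ln ?posrE ?expR_gt0.
  have lnx2 : ln x <= - (i / L) by rewrite -[leRHS]expRK ler_ln ?posrE ?expR_gt0.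
  have xs : - L * ln x \in `[i, i + 1].
    rewrite in_itv/=.
    have -> : i = L * (i / L) by field; rewrite gt_eqF.
    have -> : L * (i / L) + 1 = L * ((i + 1) / L) by field; rewrite gt_eqF.
    by rewrite !mulNr -!mulrN !ler_pM2l//; lra.
  have := smin _ xs; rewrite expLn// => gx.
  apply: ler_pM; [exact: powR_ge0|by rewrite mulr_ge0 ?powR_ge0 ?(ltW d0)| |].
    by apply: ge0_ler_powR; rewrite ?nnegrE//; exact: ltW.
  (* The factor [L * (1 - x)] stays in [[kap, B]]: the upper bound uses [expR (- z) >= 1 - z], the
     lower one [expR (1 / L) >= 1 + 1 / L] and [i >= 1]. *)
  have -> : 1 - x = (L * (1 - x)) / L by field; rewrite gt_eqF.
  have e1 := expR_ge1Dx (1 / L).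
  have e2 := expR_ge1Dx (- ((i + 1) / L)).
  have kap_1L : kap <= expR (- (1 / L)) by apply: kapL.
  have xle : x <= expR (- (1 / L)).
    by apply: le_trans x2 _; rewrite ler_expR lerN2 ler_wpM2r// ltW.
  have e12 : expR (- (1 / L)) * expR (1 / L) = 1 by rewrite -expRD addNr expR0.
  have xub : L * (1 - x) <= B.
    have -> : B = L * (B / L) by field; rewrite gt_eqF.
    rewrite ler_pM2l//.
    have : (i + 1) / L <= B / L by rewrite ler_wpM2r// ltW.
    lra.
  have xlb : kap <= L * (1 - x).
    have -> : kap = L * (kap * (1 / L)) by field; rewrite gt_eqF.
    rewrite ler_pM2l//.
    have : kap * (1 / L) <= expR (- (1 / L)) * (1 / L).
      by rewrite ler_wpM2r// divr_ge0// ltW.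
    have := ler_wpM2l (expR_ge0 (- (1 / L))) e1; rewrite e12 mulrDr mulr1.
    move: xle; lra.
  rewrite powRM ?(ltW Linv)//; last by lra.
  have -> : L^-1 `^ alpha = L `^ (- alpha).
    by rewrite -powR_inv1 ?(ltW L0)// -powRrM mulN1r.
  by rewrite ler_wpM2r ?powR_ge0// hd ?xlb.
have mT : measurable T by exact: measurable_itv.
have mF : measurable_fun [set: R] (fun x => (`|g x| `^ p * (1 - x) `^ alpha)%:E).
  apply/measurable_EFinP; apply: measurable_funM.
    by apply: (measurableT_comp (measurable_powR _)); exact: measurableT_comp.
  by apply: (measurableT_comp (measurable_powR _)); exact: measurable_funB.
have v0 : 0 <= v by exact: powR_ge0.
have intT : ((v * (d * L `^ (- alpha)) * (kap / L))%:E <= nu_norm_pow alpha p g)%E.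
  apply: (@le_trans _ _ (\int[lebesgue_measure]_(x in T)
      (`|g x| `^ p * (1 - x) `^ alpha)%:E)%E); last first.
    apply: ge0_subset_integral => //.
    exact: measurable_funTS.
    - by move=> x _; rewrite lee_fin mulr_ge0 ?powR_ge0.
    move=> x; rewrite /T/= !in_itv/= => /andP[x1 x2]; apply/andP; split.
      by apply: le_trans x1; exact: expR_ge0.
    by apply: le_trans x2 _; rewrite -expR0 ler_expR oppr_le0 divr_ge0//; lra.
  apply: (@le_trans _ _ (\int[lebesgue_measure]_(x in T)
     (cst (v * (d * L `^ (- alpha)))%:E x))%E); last first.
    apply: ge0_le_integral => //.
      by move=> x _; rewrite lee_fin !mulr_ge0 ?powR_ge0 ?(ltW d0).
    exact: measurable_funTS.
  rewrite integral_cst// EFinM.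
  apply: lee_wpmul2l; first by rewrite lee_fin !mulr_ge0 ?powR_ge0 ?(ltW d0).
  rewrite [leRHS](lebesgue_measure_itv `[expR (- ((i + 1) / L)), expR (- (i / L))])/= lte_fin ltr_expR ltrN2 ltr_pM2r//.
  have -> : i < i + 1 by lra.
  rewrite lee_fin.
  have -> : expR (- (i / L)) = expR (- ((i + 1) / L)) * expR (1 / L).
    by rewrite -expRD; congr expR; ring.
  have e1 := expR_ge1Dx (1 / L).
  have kk := kapL _ iB.
  have : kap / L <= expR (- ((i + 1) / L)) * (1 / L) by rewrite div1r ler_wpM2r// ltW.
  have := ler_wpM2l (expR_ge0 (- ((i + 1) / L))) e1; rewrite mulrDr mulr1.
  lra.
have cc : (0%R <= ((d * kap)^-1 * L `^ (alpha + 1))%:E)%E.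
  by rewrite lee_fin mulr_ge0 ?powR_ge0// invr_ge0 mulr_ge0// ltW.
apply: le_trans (lee_wpmul2l cc intT).
rewrite -EFinM lee_fin powRN powRD ?(gt_eqF L0) ?implybT// powRr1 ?(ltW L0)//.
rewrite le_eqVlt; apply/orP; left; apply/eqP.
by field; rewrite !gt_eqF ?powR_gt0.
Qed.

Lemma muntz_seq_le (R : realType) (Lam : nat -> R) : muntz_seq Lam ->
  {homo Lam : i j / (i <= j)%N >-> i <= j}.
Proof.
move=> [_ [inc _]]; apply: homo_leq => [x|y x z|i]; first exact: lexx.
  exact: le_trans.
exact: ltW.
Qed.

Lemma muntz_seq_gt0 (R : realType) (Lam : nat -> R) i : muntz_seq Lam -> 0 < Lam i.
Proof.
by move=> mL; have [L0 _] := mL; apply: lt_le_trans L0 _; exact: muntz_seq_le.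
Qed.

(** A block may have fewer than [N] terms; it is padded with zero coefficients and exponent 1, which
    lies in the range [[1, Q]] required by [expsum_bound]. *)
Lemma muntz_block_expsum (R : realType) (Lam : nat -> R) (nb : nat -> nat)
    (a : nat -> R) (k N : nat) (L : R) :
  0 < L -> (nb k.+1 - nb k <= N)%N -> forall s : R,
  muntz_block Lam nb a k (expR (- (s / L))) =
  \sum_(j < N) (if (j < nb k.+1 - nb k)%N then a (j + nb k)%N else 0) *
     expR (- (if (j < nb k.+1 - nb k)%N then Lam (j + nb k)%N / L else 1) * s).
Proof.
move=> L0 lenN s; rewrite /muntz_block -{1}[nb k]add0n big_addn big_mkord.
rewrite (big_ord_widen N (fun i => a (i + nb k)%N *
   expR (- (s / L)) `^ Lam (i + nb k)%N))// big_mkcond/=.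
apply: eq_bigr => j _; case: ifP => _; last by rewrite mul0r.
by rewrite expR_powR; congr (_ * expR _); ring.
Qed.

Lemma measurable_muntz_block (R : realType) (Lam : nat -> R) (nb : nat -> nat)
    (a : nat -> R) (k : nat) : measurable_fun [set: R] (muntz_block Lam nb a k).
Proof.
by apply: measurable_sum => i; exact: measurable_funM.
Qed.

(** [nu_norm_node] supplies nodes where the block is bounded by its norm, and [expsum_bound] extends
    this to all [s >= 0]. Half of the decay absorbs the polynomial factor. *)
Lemma muntz_block_bound (R : realType) (Lam : nat -> R) (q : R) (N : nat)
    (nb : nat -> nat) (alpha p : R) :
  muntz_seq Lam -> quasi_lacunary Lam q N nb -> 0 < p ->
  exists2 C : R, 0 < C & forall (a : nat -> R) (k : nat) (t : R), 0 <= t <= 1 ->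
    ((`|muntz_block Lam nb a k t| `^ p)%:E <=
     (C * Lam (nb k) `^ (alpha + 1) * expR (- (p / 2 * (Lam (nb k) * (1 - t)))))%:E *
      nu_norm_pow alpha p (muntz_block Lam nb a k))%E.
Proof.
move=> mL [q1 [N1 [nb0 [nbS [nbN nbq]]]]] p0.
have L0 k : 0 < Lam k by exact: muntz_seq_gt0.
have Lle := muntz_seq_le mL.
(* Leaves room for the windows [[2 * j + 1, 2 * j + 2]] with [j < 2 ^ N], which are at distance 1
   from each other. *)
pose B : R := (2 * 2 ^ N + 2)%:R.
have B1 : 1 <= B by rewrite /B ler1n; lia.
have nodeB j : (j < 2 ^ N)%N -> (2 * j + 1)%:R + 1 <= B.
  by move=> jN; rewrite /B natr1 ler_nat; lia.
have nodeS j : (2 * j.+1 + 1)%:R = (2 * j + 1)%:R + 1 + 1 :> R.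
  by rewrite !natr1; congr (_%:R); lia.
have [C1 C10 node] := @nu_norm_node R alpha p (Lam 0%N) B p0 (L0 _) B1.
have [K K0 turan] := @expsum_bound R (q ^+ (2 * N)) B (le_trans ler01 B1) N.
(* Chosen so that [(1 + x) ^+ N <= A * expR (x / 2)]. *)
pose A : R := (N%:R / 2^-1) `^ N%:R * expR (2^-1).
have A0 : 0 <= A by rewrite mulr_ge0 ?powR_ge0 ?expR_ge0.
have NR : 0 < N%:R :> R by rewrite ltr0n.
exists ((K * A) `^ p * C1 + 1); first by rewrite ltr_wpDl// mulr_ge0 ?powR_ge0// ltW.
move=> a k t /andP[t0 t1].
set L := Lam (nb k); set g := muntz_block Lam nb a k; set I := nu_norm_pow alpha p g.
have LL0 : 0 < L by exact: L0.
have I0 : (0 <= I)%E.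
  by apply: integral_ge0 => x _; rewrite lee_fin mulr_ge0 ?powR_ge0.
have lenN := nbN k.
have hE := muntz_block_expsum Lam a LL0 lenN.
set a' := fun j => if (j < nb k.+1 - nb k)%N then a (j + nb k)%N else 0.
set rho := fun j => if (j < nb k.+1 - nb k)%N then Lam (j + nb k)%N / L else 1.
have rho_bd j : (j < N)%N -> 1 <= rho j <= q ^+ (2 * N).
  move=> jN; rewrite /rho; case: ifP => [jl|_]; last by rewrite lexx exprn_ege1// ltW.
  rewrite ler_pdivlMr// mul1r Lle ?leq_addl//=.
  have /andP[_] := nbq k; apply: le_trans.
  by rewrite ler_wpM2r ?invr_ge0 ?(ltW LL0)// Lle//; lia.
have cg : continuous (fun s : R => g (expR (- (s / L)))).
  move=> s; rewrite (_ : (fun s => _) = fun s : R => \sum_(j < N) a' j * expR (- rho j * s)).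
    apply: differentiable_continuous; apply/derivable1_diffP.
    have D := @is_derive_expsum R N a' (fun j => - rho j) s; exact: ex_derive.
  by apply/funext => u; exact: hE.
have c1 : 0 < (K * A) `^ p * C1 + 1 by rewrite ltr_wpDl// mulr_ge0 ?powR_ge0// ltW.
have c2 : 0 < ((K * A) `^ p * C1 + 1) * L `^ (alpha + 1) * expR (- (p / 2 * (L * (1 - t)))).
  by rewrite !mulr_gt0 ?powR_gt0 ?expR_gt0.
have [IE|Ifin] := eqVneq I +oo%E.
  by rewrite IE gt0_muley ?lte_fin// leey.
have {Ifin} IE : I = (fine I)%:E by rewrite fineK// ge0_fin_numE// ltey.
have fI0 : 0 <= fine I by exact: fine_ge0.
rewrite IE -EFinM lee_fin.
(* No finite [s] corresponds to [t = 0]; there the block vanishes because its exponents are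
   positive. *)
have [tE|tn0] := eqVneq t 0.
  rewrite /g /muntz_block big1 ?normr0 ?powR0 ?gt_eqF//.
    by rewrite mulr_ge0// ltW.
  by move=> i _; rewrite tE powR0 ?mulr0// gt_eqF.
have tp : 0 < t by rewrite lt_def tn0.
pose M := C1 * L `^ (alpha + 1) * fine I.
have M0 : 0 <= M by rewrite !mulr_ge0 ?powR_ge0// ltW.
have nodes j : exists s : R, (j < 2 ^ N)%N ->
    (2 * j + 1)%:R <= s <= (2 * j + 1)%:R + 1 /\ `|g (expR (- (s / L)))| <= M `^ p^-1.
  have [jN|] := boolP (j < 2 ^ N)%N; last by exists 0.
  have [|||s si] := node L (2 * j + 1)%:R g _ _ _ (measurable_muntz_block _ _ _ _) cg.
  - exact: Lle.
  - by rewrite ler1n addn1.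
  - exact: nodeB.
  rewrite -/I IE -EFinM lee_fin -/M => hs; exists s => _; split => //.
  have -> : `|g (expR (- (s / L)))| = (`|g (expR (- (s / L)))| `^ p) `^ p^-1.
    by rewrite -powRrM divff ?powRr1// gt_eqF.
  by apply: ge0_ler_powR; rewrite ?nnegrE ?powR_ge0// invr_ge0 ltW.
have [s hs] := choice nodes.
(* The variable [s] belonging to [t]; [ln t <= t - 1] gives [x >= L * (1 - t)]. *)
pose x := - L * ln t.
have tE : expR (- (x / L)) = t.
  by rewrite -[RHS]lnK ?posrE// /x; congr expR; field; rewrite gt_eqF.
have lnt : ln t <= t - 1.
  by have := @expR_ge1Dx R (ln t); rewrite lnK ?posrE//; lra.
have xL : L * (1 - t) <= x.
  by rewrite /x mulNr -mulrN ler_pM2l//; lra.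
have x0 : 0 <= x by apply: le_trans xL; rewrite mulr_ge0 ?(ltW LL0)//; lra.
have := turan a' rho s (M `^ p^-1) rho_bd _ _ _ x x0.
rewrite -hE tE -/g => /(_ _ _ _) gt.
have {}gt : `|g t| <= K * M `^ p^-1 * (1 + x) ^+ N * expR (- x).
  apply: gt.
  - move=> j jN; have [/andP[s1 s2] _] := hs _ jN; apply/andP; split.
      by apply: le_trans s1; rewrite ler0n.
    by apply: le_trans s2 _; exact: nodeB.
  - move=> j jN; have [/andP[_ s2] _] := hs _ (ltnW jN); have [/andP[s1 _] _] := hs _ jN.
    by rewrite nodeS in s1; lra.
  - by move=> j jN; have [_] := hs _ jN; rewrite /g hE.
have xN : (1 + x) ^+ N <= A * expR (x / 2).
  have h2 : 0 < 2^-1 :> R by rewrite invr_gt0.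
  have := @powR_le_expR R N%:R 2^-1 NR h2 (1 + x) (addr_ge0 ler01 x0).
  rewrite powR_mulrn ?addr_ge0// /A -mulrA -expRD => /le_trans; apply.
  by rewrite le_eqVlt; apply/orP; left; apply/eqP; congr (_ * expR _); field.
have gt2 : `|g t| <= K * A * M `^ p^-1 * expR (- (x / 2)).
  apply: le_trans gt _.
  have -> : expR (- (x / 2)) = expR (x / 2) * expR (- x) by rewrite -expRD; congr expR; field.
  rewrite [leRHS](_ : _ = K * M `^ p^-1 * (A * expR (x / 2)) * expR (- x)); last by ring.
  by rewrite ler_wpM2r ?expR_ge0// ler_wpM2l// mulr_ge0 ?powR_ge0.
have KA0 : 0 <= K * A by rewrite mulr_ge0.
have : `|g t| `^ p <= (K * A * M `^ p^-1 * expR (- (x / 2))) `^ p.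
  by apply: ge0_ler_powR; rewrite ?nnegrE ?mulr_ge0 ?powR_ge0 ?expR_ge0// ltW.
move=> /le_trans; apply.
rewrite (powRM _ (mulr_ge0 KA0 (powR_ge0 _ _)) (expR_ge0 _)) (powRM _ KA0 (powR_ge0 _ _)).
rewrite -powRrM mulVf ?gt_eqF// powRr1//.
rewrite expR_powR.
have e1 : expR (p * - (x / 2)) <= expR (- (p / 2 * (L * (1 - t)))).
  rewrite ler_expR; have := ler_wpM2l (ltW p0) xL; lra.
set E := expR (- (p / 2 * _)).
have E0 : 0 <= E by exact: expR_ge0.
have P0 : 0 <= (K * A) `^ p by exact: powR_ge0.
have La0 : 0 <= L `^ (alpha + 1) by exact: powR_ge0.
apply: (@le_trans _ _ ((K * A) `^ p * M * E)).
  by rewrite ler_wpM2l// mulr_ge0.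
have := mulr_ge0 (mulr_ge0 La0 E0) fI0; rewrite /M; lra.
Qed.

(** * Summing the blocks: the embedding for one exponent *)

(** As [nb] is strictly increasing, [k <= nb k], so the first [m] blocks cover all indices below
    [m]; the other coefficients in them are 0. *)
Lemma muntz_poly_blocks (R : realType) (Lam : nat -> R) (nb : nat -> nat) (m : nat)
    (a : nat -> R) (t : R) :
  nb 0%N = 0%N -> (forall k, (nb k < nb k.+1)%N) ->
  (forall i, (m <= i)%N -> a i = 0) ->
  muntz_poly Lam m a t = \sum_(k < m) muntz_block Lam nb a k t.
Proof.
move=> nb0 nbS am.
have nbge k : (k <= nb k)%N.
  by elim: k => // k IH; exact: leq_ltn_trans IH (nbS k).
have -> : muntz_poly Lam m a t = \sum_(0 <= i < nb m) a i * t `^ Lam i.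
  rewrite (big_cat_nat (leq0n m) (nbge m))//= big_mkord [X in _ + X]big_nat_cond [X in _ + X]big1 ?addr0//.
  by move=> i /andP[/andP[mi _] _]; rewrite am// mul0r.
elim: {am} m => [|m IH]; first by rewrite nb0 big_geq// big_ord0.
by rewrite big_ord_recr/= -IH /muntz_block -big_cat_nat//= ltnW.
Qed.

(** Letting the length of [[1 - eps, 1]] tend to 0. This discards the endpoint, where the pointwise
    estimate [muntz_poly_pointwise] says nothing. *)
Lemma M_class_set1 (R : realType) (mu : {measure set R -> \bar R}) (g : R) :
  0 < g -> in_M_class mu g -> mu [set 1%R] = 0%E.
Proof.
move=> g0 [C hC].
have C0 : 0 <= C.
  have := hC 1; rewrite ltr01 lexx powR1 mulr1 => /(_ isT).
  by move=> /(le_trans (measure_ge0 _ _)); rewrite lee_fin.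
apply/eqP; rewrite eq_le measure_ge0 andbT; apply/lee_addgt0Pr => e e0; rewrite add0e.
have C1 : 0 < C + 1 by rewrite ltr_wpDl.
have ec0 : 0 < e / (C + 1) by rewrite divr_gt0.
pose eps := Num.min 1 ((e / (C + 1)) `^ g^-1).
have eps0 : 0 < eps by rewrite lt_min ltr01 powR_gt0.
have eps1 : eps <= 1 by rewrite ge_min lexx.
have epsg : eps `^ g <= e / (C + 1).
  apply: (@le_trans _ _ (((e / (C + 1)) `^ g^-1) `^ g)).
    by apply: ge0_ler_powR; rewrite ?nnegrE ?powR_ge0 ?(ltW g0) ?(ltW eps0)// ge_min lexx orbT.
  by rewrite -powRrM mulVf ?gt_eqF// powRr1// ltW.
apply: (@le_trans _ _ (mu `[(1 - eps)%R, 1%R]%classic)).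
  apply: le_measure; rewrite ?inE//.
  by move=> x ->; rewrite /= in_itv/= lexx andbT gerBl ltW.
apply: le_trans (hC eps _) _; first by rewrite eps0.
rewrite lee_fin; have := ler_wpM2l C0 epsg.
have : C * (e / (C + 1)) <= e.
  by rewrite mulrCA ler_piMr ?(ltW e0)// ler_pdivrMr// mul1r lerDl.
lra.
Qed.

(* Weighted Jensen (a Schur test): split x_k = w_k (x_k / w_k) with
   w_k = L_k^s e^{-L_k (1-t)/4}, s = (alpha+1) / (2 (p-1)); since (L_k) is lacunary,
   the sum of the w_k is O((1-t)^{-s}). *)
Lemma muntz_poly_pointwise (R : realType) (Lam : nat -> R) (q : R) (N : nat)
    (nb : nat -> nat) (alpha p : R) :
  muntz_seq Lam -> quasi_lacunary Lam q N nb -> -1 < alpha -> 1 < p ->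
  exists2 C : R, 0 < C & forall (m : nat) (a r : nat -> R) (t : R),
    (forall i, (m <= i)%N -> a i = 0) ->
    (forall k, (k < m)%N -> nu_norm_pow alpha p (muntz_block Lam nb a k) = (r k)%:E) ->
    0 <= t < 1 ->
    `|muntz_poly Lam m a t| `^ p <= C * \sum_(k < m) r k * Lam (nb k) `^ ((alpha + 1) / 2) *
       (expR (- (p / 4 * Lam (nb k) * (1 - t))) * (1 - t) `^ (- ((alpha + 1) / 2))).
Proof.
move=> mL ql al p1; have p0 : 0 < p by lra.
have [C1 C10 blk] := muntz_block_bound alpha mL ql p0.
have [q1 [N1 [nb0 [nbS [nbN nbq]]]]] := ql.
have L0 k : 0 < Lam k by exact: muntz_seq_gt0.
set gam := alpha + 1; have gam0 : 0 < gam by rewrite /gam; lra.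
pose s := gam / 2 / (p - 1).
have p10 : 0 < p - 1 by lra.
have s0 : 0 < s by rewrite !divr_gt0.
have c0 : 0 < 4^-1 :> R by rewrite invr_gt0.
have [C2 C20 lac] := lacunary_bump_sum s0 c0 q1.
exists (C2 `^ (p - 1) * C1); first by rewrite mulr_gt0 ?powR_gt0.
move=> m a r t am hr /andP[t0 t1].
pose u := 1 - t; have u0 : 0 < u by rewrite /u; lra.
pose L k := Lam (nb k); have LL0 k : 0 < L k by exact: L0.
pose w k := L k `^ s * expR (- (4^-1 * (L k * u))).
have w0 k : 0 < w k by rewrite mulr_gt0 ?powR_gt0 ?expR_gt0.
pose x k := `|muntz_block Lam nb a k t|.
have x0 k : 0 <= x k by exact: normr_ge0.
have sumw : \sum_(k < m) w k <= C2 * u `^ (- s).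
  rewrite powRN ler_pdivlMr ?powR_gt0// mulr_suml.
  have := lac (fun k => L k * u) _ _ m.
  have -> : \sum_(k < m) (L k * u) `^ s * expR (- (4^-1 * (L k * u))) =
     \sum_(k < m) w k * u `^ s.
    by apply: eq_bigr => k _; rewrite powRM ?(ltW (LL0 _)) ?(ltW u0)// /w; ring.
  apply=> k; first by rewrite mulr_gt0.
  have /andP[qk _] := nbq k; rewrite mulrA ler_wpM2r ?(ltW u0)//.
  by rewrite -ler_pdivlMr.
have sumw0 : 0 <= \sum_(k < m) w k by apply: sumr_ge0 => k _; exact: ltW.
rewrite (muntz_poly_blocks Lam t nb0 nbS am).
apply: (@le_trans _ _ ((\sum_(k < m) w k * (x k / w k)) `^ p)).
  apply: ge0_ler_powR; rewrite ?nnegrE ?(ltW p0)//.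
    by apply: sumr_ge0 => k _; rewrite mulr_ge0 ?divr_ge0 ?(ltW (w0 k)).
  apply: le_trans (ler_norm_sum _ _ _) _; apply: ler_sum => k _.
  by rewrite mulrCA divff ?mulr1// gt_eqF.
have jen := @powR_sum_le R p m (fun k => w k) (fun k => x k / w k) p1
  (fun k => ltW (w0 k)) (fun k => divr_ge0 (x0 k) (ltW (w0 k))).
apply: le_trans jen _ => /=.
(* The choice of [s] makes [s * (p - 1) = gam / 2]. *)
have W1 : (\sum_(k < m) w k) `^ (p - 1) <= C2 `^ (p - 1) * u `^ (- (gam / 2)).
  have -> : u `^ (- (gam / 2)) = (u `^ (- s)) `^ (p - 1).
    by rewrite -powRrM; congr (_ `^ _); rewrite /s; field; rewrite gt_eqF.
  rewrite -powRM ?powR_ge0 ?(ltW C20)//.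
  by apply: ge0_ler_powR; rewrite ?nnegrE ?mulr_ge0 ?powR_ge0 ?(ltW C20) ?(ltW p10).
have term k : (k < m)%N -> w k * (x k / w k) `^ p <=
    C1 * (r k * L k `^ (gam / 2) * expR (- (p / 4 * L k * u))).
  move=> km.
  have tt : 0 <= t <= 1 by rewrite t0 ltW.
  have := blk a k t tt; rewrite hr// -EFinM lee_fin -/(x k) -/(L k) -/u -/gam => hx.
  have r0 : 0 <= r k.
    rewrite -lee_fin -hr//; apply: integral_ge0 => z _.
    by rewrite lee_fin mulr_ge0 ?powR_ge0.
  have -> : w k * (x k / w k) `^ p = x k `^ p * w k `^ (1 - p).
    rewrite powRM ?invr_ge0 ?(ltW (w0 k))// -powR_inv1 ?(ltW (w0 k))// -powRrM.
    rewrite mulrCA; congr (_ * _); rewrite -{1}[w k]powRr1 ?(ltW (w0 k))//.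
    by rewrite -powRD ?(gt_eqF (w0 k)) ?implybT//; congr (_ `^ _); ring.
  have -> : w k `^ (1 - p) = L k `^ (- (gam / 2)) * expR ((p - 1) / 4 * (L k * u)).
    rewrite /w powRM ?powR_ge0 ?expR_ge0// -powRrM expR_powR; congr (_ `^ _ * expR _).
      by rewrite /s; field; rewrite gt_eqF.
    by field.
  apply: le_trans (ler_wpM2r _ hx) _; first by rewrite mulr_ge0 ?powR_ge0 ?expR_ge0.
  have Lg : L k `^ gam = L k `^ (gam / 2) * L k `^ (gam / 2).
    by rewrite -powRD ?(gt_eqF (LL0 k)) ?implybT//; congr (_ `^ _); field.
  (* The exponents combine to [- (p + 1) / 4], which is below [- p / 4]. *)
  have e : expR (- (p / 2 * (L k * u))) * expR ((p - 1) / 4 * (L k * u)) <=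
      expR (- (p / 4 * L k * u)).
    rewrite -expRD ler_expR; have := mulr_gt0 (LL0 k) u0; lra.
  rewrite powRN Lg [leLHS](_ : _ = C1 * (r k * L k `^ (gam / 2)) *
    (expR (- (p / 2 * (L k * u))) * expR ((p - 1) / 4 * (L k * u)))); last first.
    by field; rewrite gt_eqF ?powR_gt0.
  by rewrite [leRHS]mulrA ler_wpM2l ?mulr_ge0 ?powR_ge0 ?(ltW C10).
apply: (@le_trans _ _ (C2 `^ (p - 1) * u `^ (- (gam / 2)) *
   \sum_(k < m) C1 * (r k * L k `^ (gam / 2) * expR (- (p / 4 * L k * u))))).
  apply: ler_pM W1 _; first exact: powR_ge0.
    by apply: sumr_ge0 => k _; rewrite mulr_ge0 ?powR_ge0// ltW.
  by apply: ler_sum => k _; exact: term.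
rewrite le_eqVlt; apply/orP; left; apply/eqP; rewrite !mulr_sumr.
by apply: eq_bigr => k _; rewrite -/(L k) -/u; ring.
Qed.

(** The pointwise bound is integrated term by term. The kernel integral at [p / 4 * Lam (nb k)]
    contributes the power [- (alpha + 1) / 2] of [Lam (nb k)], which cancels the factor in front. *)
Lemma muntz_embedding (R : realType) (Lam : nat -> R) (q : R) (N : nat)
    (nb : nat -> nat) (alpha p : R) (mu : {measure set R -> \bar R}) :
  muntz_seq Lam -> quasi_lacunary Lam q N nb -> -1 < alpha ->
  in_M_class mu (alpha + 1) -> 1 < p ->
  exists2 C : R, 0 < C & forall (m : nat) (a : nat -> R),
    (forall i, (m <= i)%N -> a i = 0) ->
    (\int[mu]_(x in `[0%R, 1%R]%classic) (`|muntz_poly Lam m a x| `^ p)%:E <=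
     C%:E * \sum_(k < m) nu_norm_pow alpha p (muntz_block Lam nb a k))%E.
Proof.
move=> mL ql al hmu p1.
have [C1 C10 pw] := muntz_poly_pointwise mL ql al p1.
have gam0 : 0 < alpha + 1 by lra.
have gam2 : 0 < (alpha + 1) / 2 < alpha + 1 by lra.
have [C2 C20 ker] := M_class_kernel_integral hmu gam2.
have p40 : 0 < p / 4 by lra.
exists (C1 * C2 * (p / 4) `^ ((alpha + 1) / 2 - (alpha + 1))).
  by rewrite !mulr_gt0 ?powR_gt0.
set C := C1 * C2 * _.
have C0 : 0 < C by rewrite !mulr_gt0 ?powR_gt0.
move=> m a am.
pose I k := nu_norm_pow alpha p (muntz_block Lam nb a k).
have I0 k : (0 <= I k)%E.
  by apply: integral_ge0 => x _; rewrite lee_fin mulr_ge0 ?powR_ge0.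
(* An infinite right-hand side is trivial because [C > 0]; otherwise all norms are real numbers
   [r k]. *)
have [SE|Sfin] := eqVneq (\sum_(k < m) I k)%E +oo%E.
  by rewrite SE gt0_muley ?lte_fin// leey.
pose r k := fine (I k).
have hr k : (k < m)%N -> I k = (r k)%:E.
  move=> km; rewrite /r fineK// ge0_fin_numE// ltey; apply: contra Sfin => /eqP Ik.
  rewrite (bigD1 (Ordinal km))//= Ik; apply/eqP/addye.
  by rewrite gt_eqF// (lt_le_trans (ltNyr 0))// sume_ge0.
have r0 k : 0 <= r k by exact: fine_ge0.
have L0 k : 0 < Lam k by exact: muntz_seq_gt0.
pose b k := C1 * (r k * Lam (nb k) `^ ((alpha + 1) / 2)).
have b0 k : 0 <= b k by rewrite !mulr_ge0 ?powR_ge0 ?(ltW C10).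
pose K k x := expR (- (p / 4 * Lam (nb k) * (1 - x))) * (1 - x) `^ (- ((alpha + 1) / 2)).
have K0 k x : 0 <= K k x by rewrite mulr_ge0 ?expR_ge0 ?powR_ge0.
have mK k : measurable_fun [set: R] (K k).
  apply: measurable_funM.
    apply: measurableT_comp => //; apply: measurableT_comp => //.
    by apply: measurable_funM => //; exact: measurable_funB.
  by apply: (measurableT_comp (measurable_powR _)); exact: measurable_funB.
have mf : measurable_fun [set: R] (fun x => `|muntz_poly Lam m a x| `^ p).
  apply: (measurableT_comp (measurable_powR _)); apply: measurableT_comp => //.
  by apply: measurable_sum => i; exact: measurable_funM.
apply: (@le_trans _ _ (\int[mu]_(x in `[0%R, 1%R]%classic)
   (\sum_(k < m) (b k)%:E * (K k x)%:E))%E).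
  apply: ae_ge0_le_integral => //.
  - by apply/measurable_EFinP; exact: measurable_funTS.
  - by move=> x _; apply: sume_ge0 => k _; rewrite mule_ge0 ?lee_fin.
  - apply: emeasurable_sum => k; apply/measurable_EFinP/measurable_funTS.
    exact: measurable_funM.
  exists [set 1]; split; first exact: measurable_set1.
    exact: M_class_set1 hmu.
  move=> x /=; apply: contra_notP => x1.
  rewrite in_itv/= => /andP[x0 xle].
  have xlt : 0 <= x < 1 by rewrite x0 lt_neqAle xle andbT; apply/eqP.
  under eq_bigr do rewrite -EFinM; rewrite sumEFin lee_fin.
  apply: le_trans (pw m a r x am hr xlt) _.
  by rewrite mulr_sumr ler_sum// => k _; rewrite /b mulrA.
rewrite ge0_integral_sum//; last 2 first.
- move=> k; apply/measurable_EFinP/measurable_funTS; exact: measurable_funM.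
- by move=> k x _; rewrite mule_ge0 ?lee_fin.
rewrite ge0_sume_distrr => [|k _]; last exact: I0.
apply: lee_sum => k _.
rewrite ge0_integralZl_EFin//; last first.
- by apply/measurable_EFinP/measurable_funTS.
- by move=> x _; rewrite lee_fin.
have Lp : 0 < p / 4 * Lam (nb k) by rewrite mulr_gt0.
apply: le_trans (lee_wpmul2l _ (ker _ Lp)) _; first by rewrite lee_fin.
rewrite -/(I k) hr// -!EFinM lee_fin powRM ?(ltW p40) ?(ltW (L0 _))//.
rewrite /b /C le_eqVlt; apply/orP; left; apply/eqP.
have -> : Lam (nb k) `^ ((alpha + 1) / 2 - (alpha + 1)) = (Lam (nb k) `^ ((alpha + 1) / 2))^-1.
  by rewrite -powRN; congr (_ `^ _); field.
by field; rewrite gt_eqF ?powR_gt0.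
Qed.

(** * The product inequality *)

Unset Implicit Arguments.

Theorem mainTheorem4 (R : realType) (Lam : nat -> R) (q : R) (N : nat)
    (nb : nat -> nat) (alpha : R) (mu : {measure set R -> \bar R})
    (n : nat) (p : 'I_n -> R) :
  muntz_seq Lam -> quasi_lacunary Lam q N nb ->
  -1 < alpha -> in_M_class mu (alpha + 1) ->
  (forall j, 1 < p j) -> \sum_(j < n) (p j)^-1 = 1 ->
  exists C : R, forall (m : nat) (a : 'I_n -> nat -> R),
    (forall j i, (m <= i)%N -> a j i = 0) ->
    (`| \int[mu]_(x in `[0%R, 1%R]%classic) (\prod_(j < n) muntz_poly Lam m (a j) x)%:E |
      <= C%:E * \prod_(j < n)
           poweR (\sum_(k < m) nu_norm_pow alpha (p j) (muntz_block Lam nb (a j) k))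
                 (p j)^-1)%E.
Proof.
move=> mL ql al hmu p1 pE.
have p0 j : 0 < p j by apply: lt_trans (p1 j).
have emb j : exists C : R, 0 < C /\ forall (m : nat) (a : nat -> R),
    (forall i, (m <= i)%N -> a i = 0) ->
    (\int[mu]_(x in `[0%R, 1%R]%classic) (`|muntz_poly Lam m a x| `^ p j)%:E <=
     C%:E * \sum_(k < m) nu_norm_pow alpha (p j) (muntz_block Lam nb a k))%E.
  by have [C C0 hC] := muntz_embedding mL ql al hmu (p1 j); exists C.
have [D hD] := choice emb.
have C0 : 0 <= \sum_j (p j)^-1 * D j.
  by apply: sumr_ge0 => j _; have [Dj _] := hD j; rewrite mulr_ge0 ?invr_ge0// ltW.
(* The sum comes from AM-GM; adding 1 makes the constant positive, which the case of an infinite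
   factor uses. *)
exists (\sum_j (p j)^-1 * D j + 1) => m a am.
set C := _ + 1; have C1 : 0 < C by rewrite ltr_wpDl.
pose I j k := nu_norm_pow alpha (p j) (muntz_block Lam nb (a j) k).
have I0 j k : (0 <= I j k)%E.
  by apply: integral_ge0 => x _; rewrite lee_fin mulr_ge0 ?powR_ge0.
pose S j := (\sum_(k < m) I j k)%E.
have S0 j : (0 <= S j)%E by exact: sume_ge0.
(* Vanishing norms force every block to vanish on [[0, 1]], by the pointwise block bound. *)
have f_zero j x : S j = 0%E -> 0 <= x <= 1 -> muntz_poly Lam m (a j) x = 0.
  move=> Sj x01; have [_ [_ [nb0 [nbS _]]]] := ql.
  rewrite (muntz_poly_blocks _ _ nb0 nbS (am j)) big1// => k _.
  have Ijk : I j k = 0%E.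
    by apply/eqP; rewrite eq_le I0 andbT -Sj /S (bigD1 k)//= leeDl// sume_ge0.
  have [B _ /(_ (a j) k x x01)] := muntz_block_bound alpha mL ql (p0 j).
  rewrite -/(I j k) Ijk mule0 lee_fin => g0.
  apply/eqP; rewrite -normr_eq0; apply/eqP/(@powR_eq0_eq0 _ _ (p j))/eqP.
  by rewrite eq_le g0 powR_ge0.
(* Normalising divides by the [S j], so the values 0 and infinity are treated apart. Zero comes
   first, as 0 times infinity is 0 in the extended reals. *)
have [/existsP[j /eqP Sj]|] := boolP [exists j, S j == 0%E].
  rewrite (_ : \int[mu]_(x in _) _ = 0)%E.
    rewrite abse0 mule_ge0 ?lee_fin ?(ltW C1)//.
    by apply: prode_ge0 => i _; exact: poweR_ge0.
  apply: integral0_eq => x; rewrite /= in_itv/= => x01.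
  by rewrite (bigD1 j)//= f_zero// mul0r.
rewrite negb_exists => /forallP Sn0.
have Sgt0 j : (0 < S j)%E by rewrite lt_neqAle eq_sym Sn0 S0.
have [/existsP[j /eqP Sj]|] := boolP [exists j, S j == +oo%E].
  rewrite (bigD1 j)//= -/(S j) Sj poweRyr ?gt_eqF ?invr_gt0// gt0_mulye.
    by rewrite gt0_muley ?lte_fin// leey.
  apply: (big_ind (fun x => (0 < x)%E)) => [|x y|i _]; first exact: lte01.
    exact: mule_gt0.
  by apply: poweR_gt0; exact: Sgt0.
rewrite negb_exists => /forallP Snoo.
pose s j := fine (S j).
have SE j : S j = (s j)%:E by rewrite /s fineK// ge0_fin_numE// ltey.
have s0 j : 0 < s j by rewrite -lte_fin -SE.
pose T j := s j `^ (p j)^-1.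
have T0 j : 0 < T j by exact: powR_gt0.
have prodE : (\prod_(j < n) poweR (\sum_(k < m) nu_norm_pow alpha (p j)
    (muntz_block Lam nb (a j) k)) (p j)^-1)%E = (\prod_(j < n) T j)%:E.
  rewrite -prodEFin; apply: eq_bigr => j _.
  by rewrite -/(S j) SE poweR_EFin.
rewrite prodE.
set P := \prod_(j < n) T j.
have P0 : 0 < P by exact: prodr_gt0.
(* The coefficient of [|f j| ^ p j] once AM-GM is applied to [|f j| / T j] and the product [P] is
   restored; [T j] to the power [p j] is [s j]. *)
pose c j := P * (p j)^-1 / s j.
have c0 j : 0 <= c j by rewrite ltW// !mulr_gt0// invr_gt0.
pose f j x := muntz_poly Lam m (a j) x.
have mf j : measurable_fun [set: R] (f j).
  by apply: measurable_sum => i; exact: measurable_funM.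
have mfp j : measurable_fun [set: R] (fun x => `|f j x| `^ p j).
  by apply: (measurableT_comp (measurable_powR _)); exact: measurableT_comp.
have mprod : measurable_fun [set: R] (fun x => \prod_(j < n) f j x).
  exact: measurable_prod.
apply: le_trans (le_abse_integral _ _ _) _ => //.
  by apply/measurable_EFinP/measurable_funTS.
apply: (@le_trans _ _ (\int[mu]_(x in `[0%R, 1%R]%classic)
   (\sum_(j < n) (c j)%:E * (`|f j x| `^ p j)%:E))%E).
  apply: ge0_le_integral => //.
  - by apply: measurableT_comp => //; apply/measurable_EFinP/measurable_funTS.
  - apply: emeasurable_sum => j; apply/measurable_EFinP/measurable_funTS.
    exact: measurable_funM.
  move=> x _.
  rewrite [leRHS](_ : _ = (\sum_(j < n) c j * `|f j x| `^ p j)%:E); last first.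
    by rewrite -sumEFin; apply: eq_bigr => j _; rewrite EFinM.
  rewrite abse_EFin lee_fin normr_prod.
  have -> : \prod_(j < n) `|f j x| = P * \prod_(j < n) (`|f j x| / T j).
    rewrite -big_split/=; apply: eq_bigr => j _.
    by rewrite mulrCA divff ?mulr1// gt_eqF.
  have := @young_prod R n p (fun j => `|f j x| / T j) p0 pE
    (fun j => divr_ge0 (normr_ge0 _) (ltW (T0 j))).
  move=> /(ler_wpM2l (ltW P0))/le_trans; apply.
  rewrite mulr_sumr ler_sum// => j _.
  have TE : (T j)^-1 `^ p j = (s j)^-1.
    by rewrite /T -powRN -powRrM mulNr mulVf ?gt_eqF// powR_inv1// ltW.
  rewrite powRM ?invr_ge0 ?(ltW (T0 _))// TE.
  by rewrite le_eqVlt; apply/orP; left; apply/eqP; rewrite /c; ring.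
rewrite ge0_integral_sum//; last 2 first.
- move=> j; apply/measurable_EFinP/measurable_funTS; exact: measurable_funM.
- by move=> j x _; rewrite mule_ge0 ?lee_fin ?powR_ge0.
apply: (@le_trans _ _ (\sum_(j < n) (c j * (D j * s j))%:E)%E).
  apply: lee_sum => j _; rewrite ge0_integralZl_EFin//; last first.
    by apply/measurable_EFinP/measurable_funTS.
  rewrite [leRHS]EFinM; apply: lee_wpmul2l; first by rewrite lee_fin.
  have [_ hj] := hD j; apply: le_trans (hj m (a j) (am j)) _.
  by rewrite -/(S j) SE EFinM.
rewrite sumEFin -EFinM lee_fin.
(* The factors [s j] cancel, leaving the announced constant times [P]. *)
have -> : \sum_(j < n) c j * (D j * s j) = (\sum_(j < n) (p j)^-1 * D j) * P.
  rewrite mulr_suml; apply: eq_bigr => j _; rewrite /c.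
  by field; rewrite !gt_eqF.
by rewrite ler_wpM2r ?(ltW P0)// /C lerDl.
Qed.
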